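(* Let $x_1,x_2,y_1,y_2,u_1,u_2,v_1,v_2,p_{+1},p_{+2},p_{-1},p_{-2},q_{+1},q_{+2},q_{-1},q_{-2},s$ and $\mathbf w=(w_\ell)_{\ell\ge0}$ be indeterminates, and for $n\ge0$ define the polynomial $Q_n=Q_n(x_1,x_2,y_1,y_2,u_1,u_2,v_1,v_2,\mathbf w,p_{+1},p_{+2},p_{-1},p_{-2},q_{+1},q_{+2},q_{-1},q_{-2},s)$ by $$\begin{aligned}Q_n=\sum_{\sigma\in\mathfrak S_n}\;& x_1^{\mathrm{eareccpeak}(\sigma)}x_2^{\mathrm{eareccdfall}(\sigma)}y_1^{\mathrm{ereccval}(\sigma)}y_2^{\mathrm{ereccdrise}(\sigma)}\,u_1^{\mathrm{nrcpeak}(\sigma)}u_2^{\mathrm{nrcdfall}(\sigma)}v_1^{\mathrm{nrcval}(\sigma)}v_2^{\mathrm{nrcdrise}(\sigma)}\,\mathbf w^{\mathbf{fix}(\sigma)}\\ &\times p_{+1}^{\mathrm{ucrosscval}(\sigma)}p_{+2}^{\mathrm{ucrosscdrise}(\sigma)}p_{-1}^{\mathrm{lcrosscpeak}(\sigma)}p_{-2}^{\mathrm{lcrosscdfall}(\sigma)}\\ &\times q_{+1}^{\mathrm{unestcval}(\sigma)}q_{+2}^{\mathrm{unestcdrise}(\sigma)}q_{-1}^{\mathrm{lnestcpeak}(\sigma)}q_{-2}^{\mathrm{lnestcdfall}(\sigma)}s^{\mathrm{psnest}(\sigma)}.\end{aligned}$$ Then $$\sum_{n=0}^\infty Q_n\,t^n=\cfrac{1}{1-\gamma_0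 t-\cfrac{\beta_1t^2}{1-\gamma_1t-\cfrac{\beta_2t^2}{1-\gamma_2 t-\cdots}}}$$ with coefficients $\gamma_0=w_0$ and, for $n\ge1$, $$\gamma_n=\bigl(p_{-2}^{n-1}x_2+q_{-2}[n-1]_{p_{-2},q_{-2}}u_2\bigr)+\bigl(p_{+2}^{n-1}y_2+q_{+2}[n-1]_{p_{+2},q_{+2}}v_2\bigr)+s^nw_n,$$ $$\beta_n=\bigl(p_{-1}^{n-1}x_1+q_{-1}[n-1]_{p_{-1},q_{-1}}u_1\bigr)\bigl(p_{+1}^{n-1}y_1+q_{+1}[n-1]_{p_{+1},q_{+1}}v_1\bigr).$$
   Context: $[n]_{p,q}=\sum_{j=0}^{n-1}p^jq^{n-1-j}$ (so $[0]_{p,q}=0$). $\mathfrak S_n$ is the set of permutations of $[n]=\{1,\dots,n\}$. Continued fractions are identities of formal power series in $t$. For $\sigma\in\mathfrak S_n$, an index $i\in[n]$ is a record if $\sigma(j)<\sigma(i)$ for all $j<i$; an antirecord if $\sigma(j)>\sigma(i)$ for all $j>i$; an exclusive record if it is a record and not an antirecord; an exclusive antirecord if it is an antirecord and not a record; a neither-record-antirecord if it is neither a record nor an antirecord. An index $i$ is a cycle peak if $\sigma^{-1}(i)<i>\sigma(i)$; a cycle valley if $\sigma^{-1}(i)>i<\sigma(i)$; a cycle double rise if $\sigma^{-1}(i)<i<\sigma(i)$; a cycle double fall if $\sigma^{-1}(i)>i>\sigma(i)$; a fixed point if $\sigma(i)=i$. Statistics: $\mathrm{eareccpeak}(\sigma)$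 [resp. $\mathrm{eareccdfall}(\sigma)$] is the number of exclusive antirecords that are also cycle peaks [resp. cycle double falls]; $\mathrm{ereccval}(\sigma)$ [resp. $\mathrm{ereccdrise}(\sigma)$] is the number of exclusive records that are also cycle valleys [resp. cycle double rises]; $\mathrm{nrcpeak},\mathrm{nrcval},\mathrm{nrcdrise},\mathrm{nrcdfall}$ are the numbers of neither-record-antirecords that are also cycle peaks, cycle valleys, cycle double rises, cycle double falls, respectively. If $i$ is a fixed point, $\mathrm{lev}(i,\sigma)=\#\{j<i:\sigma(j)>i\}=\#\{j>i:\sigma(j)<i\}$, and $\mathbf w^{\mathbf{fix}(\sigma)}=\prod_{i:\,\sigma(i)=i}w_{\mathrm{lev}(i,\sigma)}$. Crossings and nestings: each of the following is the number of quadruplets $i<j<k<l$ in $[n]$ with the stated property. ucrosscval: $k=\sigma(i)$, $l=\sigma(j)$, $\sigma^{-1}(j)>j$. ucrosscdrise: $k=\sigma(i)$, $l=\sigma(j)$, $\sigma^{-1}(j)<j$. lcrosscpeak: $i=\sigma(k)$, $j=\sigma(l)$, $\sigma^{-1}(k)<k$. lcrosscdfall: $i=\sigma(k)$, $j=\sigma(l)$, $\sigma^{-1}(k)>k$. unestcval: $l=\sigma(i)$, $k=\sigma(j)$, $\sigma^{-1}(j)>j$. unestcdrise: $l=\sigma(i)$, $k=\sigma(j)$, $\sigma^{-1}(j)<j$. lnestcpeak: $i=\sigma(l)$, $j=\sigma(k)$, $\sigma^{-1}(k)<k$. lnestcdfall: $i=\sigma(l)$, $j=\sigma(k)$, $\sigma^{-1}(k)>k$.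 Finally $\mathrm{psnest}(\sigma)$ is the number of triplets $i<j<l$ with $\sigma(j)=j$ and $l=\sigma(i)$ (equivalently, the number of triplets $i<j<l$ with $\sigma(j)=j$ and $i=\sigma(l)$). *)

(* Defs.v *)
From HB Require Import structures.
From mathcomp Require Import all_boot all_order all_algebra all_fingroup zify.

Set Implicit Arguments.
Unset Strict Implicit.
Unset Printing Implicit Defensive.

Import GRing.Theory.

Local Open Scope ring_scope.

(* [n]_{p,q} *)
Definition pqnum (R : comNzRingType) (p q : R) (n : nat) : R :=
  \sum_(j < n) p ^+ j * q ^+ (n - 1 - j).

(* Formal power series in t, given by their coefficients. *)
Definition fps (R : comNzRingType) := nat -> R.

Section FormalPowerSeries.
Variable R : comNzRingType.
Implicit Types f g h : fps R.

Definition fps_const (c : R) : fps R := fun n => if n == 0%N then c else 0.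
Definition fps_sub f g : fps R := fun n => f n - g n.
Definition fps_mul f g : fps R := fun n => \sum_(i < n.+1) f i * g (n - i)%N.
Definition fps_exp f (k : nat) : fps R := iter k (fps_mul f) (fps_const 1).

(* c t^d *)
Definition fps_monom (c : R) (d : nat) : fps R :=
  fun n => if n == d then c else 0.

(* 1/f for f with constant term 1, as the geometric series in 1 - f; the
   coefficient of t^n only receives contributions from (1 - f)^k, k <= n.
   See [fps_mul_inv]. *)
Definition fps_inv f : fps R :=
  fun n => \sum_(k < n.+1) fps_exp (fps_sub (fps_const 1) f) k n.

Lemma fps_exp_low g k n : g 0%N = 0 -> (n < k)%N -> fps_exp g k n = 0.
Proof.
move=> g0; elim: k n => // k IH n ltnk.
rewrite /fps_exp iterS -/(fps_exp g k) /fps_mul big1 // => i _.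
case: (posnP i) => [->|i_gt0]; first by rewrite g0 mul0r.
rewrite IH ?mulr0 //; have := ltn_ord i; lia.
Qed.

Lemma fps_mul_inv f : f 0%N = 1 -> fps_mul f (fps_inv f) =1 fps_const 1.
Proof.
move=> f0 n; pose g := fps_sub (fps_const 1) f.
have g0 : g 0%N = 0 by rewrite /g /fps_sub /fps_const /= f0 subrr.
pose F k := fps_exp g k n.
have step k : \sum_(i < n.+1) f i * fps_exp g k (n - i)%N = F k - F k.+1.
  have -> : F k.+1 =
      \sum_(i < n.+1) (fps_const 1 i - f i) * fps_exp g k (n - i)%N.
    by rewrite /F /fps_exp iterS.
  under [in RHS]eq_bigr do rewrite mulrBl.
  rewrite sumrB opprB addrCA -[LHS]addr0; congr (_ + _).
  apply/esym/eqP; rewrite subr_eq0 big_ord_recl /= mul1r subn0 big1 ?addr0 //.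
  by move=> i _; rewrite mul0r.
transitivity (\sum_(k < n.+1) (F k - F k.+1)).
  under [RHS]eq_bigr do rewrite -step.
  rewrite exchange_big; apply: eq_bigr => i _; rewrite -mulr_sumr; congr (_ * _).
  rewrite /fps_inv -/g (big_ord_widen n.+1 (fun k => fps_exp g k (n - i)%N)).
    rewrite big_mkcond; apply: eq_bigr => k _; case: ltnP => // lt_k.
    by rewrite fps_exp_low.
  by rewrite ltnS leq_subr.
rewrite -(big_mkord xpredT (fun k => F k - F k.+1)) sumrB.
rewrite big_nat_recl // [X in _ - X]big_nat_recr //= opprD addrA addrK.
by rewrite [F n.+1]fps_exp_low // subr0.
Qed.

(* Truncation at depth k of the J-fraction starting at level m:
     1 / (1 - gamma_m t - beta_{m+1} t^2 / (1 - gamma_{m+1} t - ...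
                        - beta_{m+k} t^2 / (1 - gamma_{m+k} t))) *)
Fixpoint Jconvergent (gamma beta : nat -> R) (k m : nat) : fps R :=
  let d := fps_sub (fps_const 1) (fps_monom (gamma m) 1) in
  match k with
  | 0 => fps_inv d
  | k'.+1 =>
      fps_inv (fps_sub d (fps_mul (fps_monom (beta m.+1) 2)
                                  (Jconvergent gamma beta k' m.+1)))
  end.

(* f is the infinite J-fraction, i.e. the t-adic limit of its convergents:
   each coefficient of the convergents is eventually constant, equal to that
   of f. *)
Definition is_Jfraction (gamma beta : nat -> R) (f : fps R) : Prop :=
  forall n, exists K, forall k, (K <= k)%N -> Jconvergent gamma beta k 0 n = f n.

End FormalPowerSeries.

(* The index set [n] = {1,...,n} is represented by 'I_n = {0,...,n-1}: the
   statistics depend only on the relative order of the indices. *)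
Section Statistics.
Variables (n : nat) (sg : 'S_n).
Implicit Types i j k l : 'I_n.

Local Notation sgi := (sg^-1)%g.

Local Open Scope nat_scope.

Definition record i := [forall j : 'I_n, (j < i) ==> (sg j < sg i)].
Definition antirecord i := [forall j : 'I_n, (i < j) ==> (sg i < sg j)].
Definition exrecord i := record i && ~~ antirecord i.
Definition exantirecord i := antirecord i && ~~ record i.
Definition neither_record i := ~~ record i && ~~ antirecord i.

Definition cpeak i := (sgi i < i) && (sg i < i).
Definition cval i := (i < sgi i) && (i < sg i).
Definition cdrise i := (sgi i < i) && (i < sg i).
Definition cdfall i := (i < sgi i) && (sg i < i).

Definition eareccpeak := #|[set i | exantirecord i && cpeak i]|.
Definition eareccdfall := #|[set i | exantirecord i && cdfall i]|.
Definition ereccval := #|[set i | exrecord i && cval i]|.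
Definition ereccdrise := #|[set i | exrecord i && cdrise i]|.
Definition nrcpeak := #|[set i | neither_record i && cpeak i]|.
Definition nrcval := #|[set i | neither_record i && cval i]|.
Definition nrcdrise := #|[set i | neither_record i && cdrise i]|.
Definition nrcdfall := #|[set i | neither_record i && cdfall i]|.

Definition lev i := #|[set j : 'I_n | (j < i) && (i < sg j)]|.

Definition nquad (P : 'I_n -> 'I_n -> 'I_n -> 'I_n -> bool) :=
  #|[set q : ('I_n * 'I_n * 'I_n * 'I_n)%type |
      let: (i, j, k, l) := q in [&& i < j, j < k, k < l & P i j k l]]|.

Definition ucrosscval :=
  nquad (fun i j k l => [&& k == sg i, l == sg j & j < sgi j]).
Definition ucrosscdrise :=
  nquad (fun i j k l => [&& k == sg i, l == sg j & sgi j < j]).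
Definition lcrosscpeak :=
  nquad (fun i j k l => [&& i == sg k, j == sg l & sgi k < k]).
Definition lcrosscdfall :=
  nquad (fun i j k l => [&& i == sg k, j == sg l & k < sgi k]).
Definition unestcval :=
  nquad (fun i j k l => [&& l == sg i, k == sg j & j < sgi j]).
Definition unestcdrise :=
  nquad (fun i j k l => [&& l == sg i, k == sg j & sgi j < j]).
Definition lnestcpeak :=
  nquad (fun i j k l => [&& i == sg l, j == sg k & sgi k < k]).
Definition lnestcdfall :=
  nquad (fun i j k l => [&& i == sg l, j == sg k & k < sgi k]).

Definition psnest :=
  #|[set q : ('I_n * 'I_n * 'I_n)%type |
      let: (i, j, l) := q in [&& i < j, j < l, sg j == j & l == sg i]]|.

End Statistics.

(* The suffixes p and m stand for the subscripts + and -: pp1 = p_{+1},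
   pm1 = p_{-1}, qp1 = q_{+1}, qm1 = q_{-1}, etc. *)
Definition Qpoly (R : comNzRingType)
    (x1 x2 y1 y2 u1 u2 v1 v2 : R) (w : nat -> R)
    (pp1 pp2 pm1 pm2 qp1 qp2 qm1 qm2 s : R) (n : nat) : R :=
  \sum_(sg : 'S_n)
    x1 ^+ eareccpeak sg * x2 ^+ eareccdfall sg *
    y1 ^+ ereccval sg * y2 ^+ ereccdrise sg *
    u1 ^+ nrcpeak sg * u2 ^+ nrcdfall sg *
    v1 ^+ nrcval sg * v2 ^+ nrcdrise sg *
    (\prod_(i : 'I_n | sg i == i) w (lev sg i)) *
    pp1 ^+ ucrosscval sg * pp2 ^+ ucrosscdrise sg *
    pm1 ^+ lcrosscpeak sg * pm2 ^+ lcrosscdfall sg *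
    qp1 ^+ unestcval sg * qp2 ^+ unestcdrise sg *
    qm1 ^+ lnestcpeak sg * qm2 ^+ lnestcdfall sg *
    s ^+ psnest sg.

(* Main.v *)
Require Import Defs.
From HB Require Import structures.
From mathcomp Require Import all_boot all_order all_algebra all_fingroup.
From mathcomp Require Import zify ring.

(** A permutation is determined by a labelled Motzkin path, in the manner of
    Foata and Zeilberger, and all the statistics can be read off the steps of
    this path one at a time.

    Let the height at i be the number of j < i with sigma(j) >= i.  From i to
    i+1 the height goes up at a cycle valley, goes down at a cycle peak, and
    stays the same otherwise.  The label of i counts the larger values to its
    left if sigma(i) > i, and the smaller values to its right otherwise.  If
    sigma(i) > i, the label is the number of upper nestings in which i starts
    the inner arc; the upper arcs over i that do not nest cross, so the
    crossings are counted by the height minus the label, or that minus one at a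
    cycle double rise; and i is a record exactly when its label is zero.  If
    sigma(i) < i the same holds with lower arcs and antirecords, always with
    the minus one.  A fixed point has its level as height and as label.  So the
    summand of Q_n is a product of local weights, each depending on the height,
    the type and the label of one index ([Qpoly_letter]).

    The path determines the permutation ([code_inj]): its shape gives the
    excedances and their values, and then the labels tell which value to take,
    running through the excedances from right to left and through the other
    indices from left to right.  That every path with labels in the allowed
    range occurs is seen by counting them: there are n! of length n
    ([size_words]).

    So Q_n is a weighted sum over Motzkin paths, in which a step is weighted by
    the sum of the local weights over its labels ([sum_pq_weight]).  Such path
    sums satisfy a three-term recurrence in the length and the starting height,
    and its solution at height 0 is generated by the J-fraction
    ([Jfraction_of_recurrence]). *)

Set Implicit Arguments.
Unset Strict Implicit.
Unset Printing Implicit Defensive.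

Import GRing.Theory.

(** * Labelled Motzkin paths *)

(** The letter (a, b, r) at index i stands for a = (i < sigma(i)),
    b = (sigma^-1(i) < i) and the label r.  Cycle valleys are (true, false),
    cycle peaks (false, true), cycle double rises (true, true); the pair
    (false, false) is shared by cycle double falls and fixed points. *)
Definition letter : eqType := (bool * bool * nat)%type.

(** At height h, with h arcs open, an index that closes no upper arc has h + 1
    labels available, and one that closes an upper arc has h. *)
Definition steps (h : nat) : seq letter :=
  [seq (ab, r) | ab <- [:: (true, false); (true, true); (false, true);
                           (false, false)],
                 r <- iota 0 (h + ~~ ab.2)].

(** The truncated subtraction is harmless: a letter of [steps 0] has b = false. *)
Definition next_height (h : nat) (x : letter) : nat := h + x.1.1 - x.1.2.

Fixpoint words (n h : nat) : seq (seq letter) :=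
  if n is m.+1 then [seq x :: v | x <- steps h, v <- words m (next_height h x)]
  else if h == 0 then [:: [::]] else [::].

Lemma mem_steps h (x : letter) : (x \in steps h) = (x.2 < h + ~~ x.1.2).
Proof.
apply/allpairsPdep/idP => [[ab [r [_ r_in ->]]]|lt_x].
  by move: r_in; rewrite mem_iota.
case: x lt_x => [[a b] r] /= lt_r; exists (a, b), r; split=> //.
  by case: a b {lt_r} => [] [].
by rewrite mem_iota.
Qed.

Lemma mem_words_ord n (x : 'I_n -> letter) (h : nat -> nat) :
    (forall i, x i \in steps (h i)) ->
    (forall i : 'I_n, h i.+1 = next_height (h i) (x i)) ->
    h n = 0 ->
  [seq x i | i <- enum 'I_n] \in words n (h 0).
Proof.
elim: n x h => [|n IH] x h x_in hS hn0.
  by rewrite [enum _]size0nil ?size_enum_ord //= hn0.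
rewrite enum_ordSl /=; apply/allpairsPdep.
exists (x ord0), [seq x (lift ord0 i) | i <- enum 'I_n]; split=> //.
  rewrite -[next_height _ _]/(next_height (h (ord0 : 'I_n.+1)) (x ord0)) -hS.
  apply: (IH _ (fun i => h i.+1)) => // i.
  exact: (hS (lift ord0 i)).
by rewrite /= -map_comp.
Qed.

(** There are h + 1 up steps, 2h + 1 level steps and h down steps from height h,
    so the numbers c(n, h) of words satisfy
    c(n+1, h) = (h+1) c(n, h+1) + (2h+1) c(n, h) + h c(n, h-1).
    The coefficients of z^h in the iterates at 1 of the operator y d/dy y, with
    y = 1 + z, satisfy the same recurrence; as this operator sends y^k to
    (k+1) y^(k+1), its n-th iterate at 1 is n! y^n. *)
Lemma size_words n h : size (words n h) = n`! * 'C(n, h).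
Proof.
elim: n h => [|n IH] h; first by case: h.
rewrite /= size_allpairs_dep /steps /= !map_cat !sumn_cat -!map_comp.
have sumn_r a b : sumn [seq size (words n (next_height h ((a, b), r)))
      | r <- iota 0 (h + ~~ b)] = (h + ~~ b) * (n`! * 'C(n, h + a - b)).
  under eq_map do rewrite IH.
  by elim: (h + ~~ b) (0) => //= k IHk m; rewrite IHk mulSn.
rewrite /comp /= !sumn_r /= !addn0 !addn1 !subn0 ![_ * (n`! * _)]mulnCA.
rewrite -!mulnDr factS [n.+1 * _]mulnC -mulnA; congr (_ * _).
have := mul_bin_diag n.+1 h; case: h {sumn_r} => [|h] /=.
  by rewrite !bin0 ?bin1; nia.
have := mul_bin_diag n.+1 h; rewrite !subn1 /= !binS; nia.
Qed.

Section Weights.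
Local Open Scope ring_scope.
Variables (R : comNzRingType) (W : nat -> letter -> R).

Fixpoint weight (h : nat) (v : seq letter) : R :=
  if v is x :: v' then W h x * weight (next_height h x) v' else 1.

Definition path_sum n h := \sum_(v <- words n h) weight h v.

Lemma path_sumS n h :
  path_sum n.+1 h = \sum_(x <- steps h) W h x * path_sum n (next_height h x).
Proof.
rewrite /path_sum big_allpairs_dep; apply: eq_bigr => x _.
by rewrite mulr_sumr.
Qed.

Lemma weight_ord n (x : 'I_n -> letter) (h : nat -> nat) :
    (forall i : 'I_n, h i.+1 = next_height (h i) (x i)) ->
  weight (h 0%N) [seq x i | i <- enum 'I_n] = \prod_(i < n) W (h i) (x i).
Proof.
elim: n x h => [|n IH] x h hS.
  by rewrite [enum _]size0nil ?size_enum_ord //= big_ord0.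
rewrite enum_ordSl big_ord_recl /= -map_comp; congr (_ * _).
rewrite -[next_height _ _]/(next_height (h (ord0 : 'I_n.+1)) (x ord0)) -hS.
rewrite (IH _ (fun i => h i.+1)) => [|i]; first exact: eq_bigr.
exact: (hS (lift ord0 i)).
Qed.

Lemma big_steps h (E : letter -> R) :
  \sum_(x <- steps h) E x =
    \sum_(r < h.+1) E (true, false, r : nat) +
    (\sum_(r < h) E (true, true, r : nat) +
    (\sum_(r < h) E (false, true, r : nat) +
     \sum_(r < h.+1) E (false, false, r : nat))).
Proof.
rewrite /steps big_allpairs_dep /= !big_cons big_nil addr0 /= addn1 addn0.
have big_iota a b k : \sum_(r <- iota 0 k) E (a, b, r) =
    \sum_(r < k) E (a, b, r : nat).
  by rewrite -(big_mkord xpredT (fun r => E (a, b, r))) /index_iota subn0.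
by rewrite !big_iota.
Qed.

End Weights.

(** * The path of a permutation *)

Lemma card_set_sum (T : finType) (P : pred T) : #|[set x | P x]| = \sum_x P x.
Proof.
rewrite cardsE -sum1_card big_mkcond; apply: eq_bigr => x _.
by rewrite unfold_in; case: (P x).
Qed.

Lemma card_set_perm (T : finType) (s : {perm T}) (P : pred T) :
  #|[set x | P (s x)]| = #|[set x | P x]|.
Proof. by rewrite !card_set_sum [RHS](reindex_inj (@perm_inj _ s)). Qed.

(** In a strictly totally ordered set S, an element is determined by the number
    of elements above it.  This is how a label gives back a value. *)
Lemma card_above_inj (T : finType) (r : rel T) (S : {set T}) (x y : T) :
    irreflexive r -> transitive r -> (forall z t, z != t -> r z t || r t z) ->
    x \in S -> y \in S ->
    #|[set v in S | r x v]| = #|[set v in S | r y v]| -> x = y.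
Proof.
move=> rxx r_trans r_total xS yS.
have smaller a b : b \in S -> r a b ->
    #|[set v in S | r b v]| < #|[set v in S | r a v]|.
  move=> bS rab; apply/proper_card/properP; split.
    by apply/subsetP=> v; rewrite !inE => /andP[-> /(r_trans _ _ _ rab)].
  by exists b; rewrite !inE bS ?rab ?rxx.
move=> eq_card; apply/eqP/idPn => /r_total/orP[] /smaller => [/(_ yS)|/(_ xS)].
  by rewrite eq_card ltnn.
by rewrite eq_card ltnn.
Qed.

Section Code.
Variable n : nat.
Implicit Types (s t : 'S_n) (i j : 'I_n).

Definition height s (i : nat) := #|[set j : 'I_n | j < i <= s j]|.

Definition label s i :=
  if i < s i then #|[set j : 'I_n | (j < i) && (s i < s j)]|
  else #|[set j : 'I_n | (i < j) && (s j < s i)]|.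

Definition perm_letter s i : letter := (i < s i, (s^-1)%g i < i, label s i).

Definition code s := [seq perm_letter s i | i <- enum 'I_n].

Lemma height0 s : height s 0 = 0.
Proof. by apply/eqP; rewrite cards_eq0; apply/eqP/setP => j; rewrite !inE. Qed.

Lemma height_n s : height s n = 0.
Proof.
apply/eqP; rewrite cards_eq0; apply/eqP/setP => j; rewrite !inE.
by rewrite [n <= _]leqNgt (ltn_ord (s j)) andbF.
Qed.

(** As many indices below k have their value at k or above as the other way
    round, because the indices and the values below k are equally many. *)
Lemma height_lower s k : height s k = #|[set j : 'I_n | s j < k <= j]|.
Proof.
apply/eqP; rewrite -(eqn_add2r #|[set j : 'I_n | (j < k) && (s j < k)]|).
apply/eqP; transitivity #|[set j : 'I_n | j < k]|.
  rewrite /height !card_set_sum -big_split; apply: eq_bigr => j _ /=; lia.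
rewrite -(card_set_perm s) !card_set_sum -big_split.
by apply: eq_bigr => j _ /=; lia.
Qed.

Lemma eq_permV s i j : (j == (s^-1)%g i) = (s j == i).
Proof. by apply/eqP/eqP => [->|<-]; rewrite ?permKV ?permK. Qed.

Lemma height_lev s i : height s i = lev s i + ((s^-1)%g i < i).
Proof.
rewrite /height (cardsD1 ((s^-1)%g i)) inE permKV leqnn andbT addnC.
congr (_ + _); apply: eq_card => j; rewrite !inE eq_permV -val_eqE /=; lia.
Qed.

Lemma heightS_lev s i : height s i.+1 = lev s i + (i < s i).
Proof.
rewrite /height (cardsD1 i) inE ltnSn /= addnC.
congr (_ + _); apply: eq_card => j; rewrite !inE -val_eqE /=; lia.
Qed.

(** The analogue of [lev] for lower arcs.  The two agree except at cycle double
    rises and cycle double falls, where they differ by one. *)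
Definition colev s i := #|[set j : 'I_n | s j < i < j]|.

Lemma height_colev s i : height s i = colev s i + (s i < i).
Proof.
rewrite height_lower (cardsD1 i) inE leqnn andbT addnC.
congr (_ + _); apply: eq_card => j; rewrite !inE -val_eqE /=; lia.
Qed.

Lemma heightS_colev s i : height s i.+1 = colev s i + (i < (s^-1)%g i).
Proof.
rewrite height_lower (cardsD1 ((s^-1)%g i)) inE permKV ltnSn /= addnC.
congr (_ + _); apply: eq_card => j; rewrite !inE eq_permV -val_eqE /=; lia.
Qed.

Lemma heightS s i : height s i.+1 = next_height (height s i) (perm_letter s i).
Proof. by rewrite heightS_lev height_lev /next_height /= addnAC addnK. Qed.

Lemma label_lev s i : label s i <= lev s i.
Proof.
rewrite /label; case: ltnP => [lt_i|le_i].
  apply/subset_leq_card/subsetP => j; rewrite !inE; lia.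
have -> : lev s i = height s i.+1 by rewrite heightS_lev; lia.
rewrite heightS_colev (leq_trans _ (leq_addr _ _)) //.
apply/subset_leq_card/subsetP => j; rewrite !inE; lia.
Qed.

Lemma perm_letter_steps s i : perm_letter s i \in steps (height s i).
Proof. rewrite mem_steps /= height_lev; have := label_lev s i; lia. Qed.

Lemma code_words s : code s \in words n 0.
Proof.
rewrite -(height0 s); apply: mem_words_ord (height_n s) => i.
  exact: perm_letter_steps.
exact: heightS.
Qed.

(** The values of excedances that are not taken by an index right of i form a set
    in which the label is the rank of s i from the top: any value greater than
    s i whose index is at most i is the value of an excedance. *)
Lemma label_exc s i : i < s i ->
  label s i = #|[set v : 'I_n in
     [set v : 'I_n | (s^-1)%g v < v & (s^-1)%g v <= i] | s i < v]|.
Proof.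
move=> lt_i; rewrite /label lt_i -[RHS](card_set_perm s).
apply: eq_card => j; rewrite !inE permK.
have [->|] := eqVneq j i; first by rewrite !ltnn /= andbF.
rewrite -val_eqE /=; lia.
Qed.

Lemma label_nexc s i : s i <= i ->
  label s i = #|[set v : 'I_n in
     [set v : 'I_n | v <= (s^-1)%g v & i <= (s^-1)%g v] | v < s i]|.
Proof.
move=> le_i; rewrite /label ltnNge le_i -[RHS](card_set_perm s).
apply: eq_card => j; rewrite !inE permK.
have [->|] := eqVneq j i; first by rewrite !ltnn /= andbF.
rewrite -val_eqE /=; lia.
Qed.

Lemma permV_agree s t v : s ((t^-1)%g v) = t ((t^-1)%g v) ->
  (s^-1)%g v = (t^-1)%g v.
Proof. by rewrite permKV => {1}<-; rewrite permK. Qed.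

(** Two permutations with the same code have the same excedances and the same
    set of values of excedances.  Suppose that they agree on the excedances
    right of an excedance i.  Then the sets of values still available at i
    are equal, and the label singles out the same value in them.  The other
    indices are treated in the same way from left to right. *)
Lemma code_inj : injective code.
Proof.
move=> s t eq_code.
have eq_l i : perm_letter s i = perm_letter t i.
  have /eq_in_map/(_ i) := eq_code; apply; exact: mem_enum.
have eq_exc i : (i < s i) = (i < t i) by case: (eq_l i).
have eq_val i : ((s^-1)%g i < i) = ((t^-1)%g i < i) by case: (eq_l i).
have eq_label i : label s i = label t i by case: (eq_l i).
(* Descending induction on i. *)
have exc_eq i : i < s i -> s i = t i.
  have [m le_m] := ubnP (n - i); elim: m i le_m => // m IH i le_m lt_i.
  have lt_ti : i < t i by rewrite -eq_exc.
  have eqS : [set v : 'I_n | (s^-1)%g v < v & (s^-1)%g v <= i] =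
             [set v : 'I_n | (t^-1)%g v < v & (t^-1)%g v <= i].
    apply/setP => v; rewrite !inE -eq_val; case: ltnP => //= lt_v.
    have lt_tv : (t^-1)%g v < v by rewrite -eq_val.
    apply/idP/idP; apply: contraLR; rewrite -!ltnNge => lt_iv.
      rewrite (@permV_agree s t) // IH ?eq_exc ?permKV //.
      by have := ltn_ord i; lia.
    rewrite (@permV_agree t s) // -IH ?permKV //.
    by have := ltn_ord i; lia.
  apply: (@card_above_inj _ (fun x y : 'I_n => x < y)
     [set v : 'I_n | (s^-1)%g v < v & (s^-1)%g v <= i]).
  - by move=> x; rewrite ltnn.
  - by move=> x y z; apply: ltn_trans.
  - by move=> x y; rewrite -val_eqE /= neq_ltn.
  - by rewrite inE permK lt_i leqnn.
  - by rewrite eqS inE permK lt_ti leqnn.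
  by rewrite -label_exc // eqS -label_exc.
(* Ascending induction on i. *)
have nexc_eq i : s i <= i -> s i = t i.
  have [m le_m] := ubnP i; elim: m i le_m => // m IH i le_m le_i.
  have le_ti : t i <= i by rewrite leqNgt -eq_exc -leqNgt.
  have eqS : [set v : 'I_n | v <= (s^-1)%g v & i <= (s^-1)%g v] =
             [set v : 'I_n | v <= (t^-1)%g v & i <= (t^-1)%g v].
    apply/setP => v; rewrite !inE [v <= _]leqNgt [v <= (t^-1)%g _]leqNgt -eq_val.
    case: ltnP => //= le_v.
    have le_tv : v <= (t^-1)%g v by rewrite leqNgt -eq_val -leqNgt.
    apply/idP/idP; apply: contraLR; rewrite -!ltnNge => lt_iv.
      rewrite (@permV_agree s t) // IH //; first lia.
      by rewrite leqNgt eq_exc permKV -leqNgt.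
    rewrite (@permV_agree t s) // -IH ?permKV //; lia.
  apply: (@card_above_inj _ (fun x y : 'I_n => y < x)
     [set v : 'I_n | v <= (s^-1)%g v & i <= (s^-1)%g v]).
  - by move=> x; rewrite ltnn.
  - by move=> x y z xy yz; apply: ltn_trans yz xy.
  - by move=> x y; rewrite -val_eqE /= neq_ltn orbC.
  - by rewrite inE permK le_i leqnn.
  - by rewrite eqS inE permK le_ti leqnn.
  by rewrite -label_nexc // eqS -label_nexc.
by apply/permP => i; case: (ltnP i (s i)) => [/exc_eq|/nexc_eq].
Qed.

(** The codes are pairwise distinct members of [words n 0], and there are n! of
    both, so no word is missing or repeated. *)
Lemma perm_code : perm_eq [seq code s | s <- enum {perm 'I_n}] (words n 0).
Proof.
have codes_uniq : uniq [seq code s | s <- enum {perm 'I_n}].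
  by rewrite map_inj_uniq ?enum_uniq //; apply: code_inj.
have codes_sub : {subset [seq code s | s <- enum {perm 'I_n}] <= words n 0}.
  by move=> v /mapP[s _ ->]; apply: code_words.
have size_le : size (words n 0) <= size [seq code s | s <- enum {perm 'I_n}].
  by rewrite size_words bin0 muln1 size_map -cardE -(card_Sn n).
apply: uniq_perm => //; first exact: leq_size_uniq size_le.
by case: (uniq_min_size codes_uniq codes_sub size_le).
Qed.

Lemma sum_weight_code (R : comNzRingType) (W : nat -> letter -> R) :
  (\sum_(s : 'S_n) \prod_(i < n) W (height s i) (perm_letter s i) =
   path_sum W n 0)%R.
Proof.
rewrite /path_sum -(perm_big _ perm_code) big_map big_enum /=.
apply: eq_bigr => s _; rewrite -[X in weight W X](height0 s) weight_ord //.
exact: heightS.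
Qed.

End Code.

(** * Statistics as sums over indices *)

Section Statistics.
Variable n : nat.
Implicit Types (i j k l : 'I_n).

(** Pairs of arcs, and pairs of an arc and a fixed point, are parametrized by two
    indices: the one, j, at which the pair is counted, and the start i of the
    other arc. *)
Lemma card_pair_param (T : finType) (f : 'I_n * 'I_n -> T) (g : T -> 'I_n * 'I_n)
    (P c : pred _) (D : rel 'I_n) :
    cancel f g -> (forall q, P q -> q = f (g q)) ->
    (forall j i, P (f (j, i)) = c j && D j i) ->
  #|[set q | P q]| = \sum_j c j * #|[set i | D j i]|.
Proof.
move=> fK PfK Pf.
transitivity #|[set f p | p in [set p | c p.1 && D p.1 p.2]]|.
  apply: eq_card => q; rewrite inE; apply/idP/imsetP => [Pq|[[j i]]].
    exists (g q); last exact: PfK.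
    by rewrite inE -Pf -surjective_pairing -PfK.
  by rewrite inE -Pf => Pji ->.
rewrite card_imset; last exact: can_inj fK.
rewrite card_set_sum -(pair_bigA _ (fun j i => nat_of_bool (c j && D j i))) /=.
apply: eq_bigr => j _; rewrite card_set_sum big_distrr /=.
by apply: eq_bigr => i _; rewrite mulnb.
Qed.

(** Both orders of the two ends occur, so F and G keep this uniform: for crossings
    they are the values at i and at j, for nestings the values at j and at i. *)
Lemma nquad_upper P (F G : 'I_n -> 'I_n -> 'I_n) (T : pred 'I_n) :
    (forall i j k l, P i j k l = [&& k == F i j, l == G i j & T j]) ->
  nquad P =
  \sum_j T j * #|[set i : 'I_n | [&& i < j, j < F i j & F i j < G i j]]|.
Proof.
move=> PE; apply: (card_pair_param
  (f := fun p => (p.2, p.1, F p.2 p.1, G p.2 p.1))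
  (g := fun q => (q.1.1.2, q.1.1.1))
  (D := fun j i => [&& i < j, j < F i j & F i j < G i j])).
- by move=> [].
- by move=> [[[i j] k] l] /and4P[_ _ _]; rewrite PE => /and3P[/eqP-> /eqP-> _].
by move=> j i /=; rewrite PE !eqxx /= !andbA andbC !andbA.
Qed.

Lemma nquad_lower P (F G : 'I_n -> 'I_n -> 'I_n) (T : pred 'I_n) :
    (forall i j k l, P i j k l = [&& i == F k l, j == G k l & T k]) ->
  nquad P =
  \sum_k T k * #|[set l : 'I_n | [&& F k l < G k l, G k l < k & k < l]]|.
Proof.
move=> PE; apply: (card_pair_param
  (f := fun p => (F p.1 p.2, G p.1 p.2, p.1, p.2))
  (g := fun q => (q.1.2, q.2))
  (D := fun k l => [&& F k l < G k l, G k l < k & k < l])).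
- by move=> [].
- by move=> [[[i j] k] l] /and4P[_ _ _]; rewrite PE => /and3P[/eqP-> /eqP-> _].
by move=> k l /=; rewrite PE !eqxx /= !andbA andbC !andbA.
Qed.

Variable s : 'S_n.

Lemma psnest_sum : psnest s = \sum_(j < n) (s j == j) * lev s j.
Proof.
apply: (card_pair_param (f := fun p => (p.2, p.1, s p.2))
  (g := fun q => (q.1.2, q.1.1)) (c := fun j => s j == j)
  (D := fun j i => (i < j) && (j < s i))).
- by move=> [].
- by move=> [[i j] l] /and4P[_ _ _ /eqP ->].
by move=> j i /=; rewrite eqxx andbT andbA andbC.
Qed.

Definition ucross j := #|[set i : 'I_n | [&& i < j, j < s i & s i < s j]]|.
Definition unest j := #|[set i : 'I_n | [&& i < j, j < s j & s j < s i]]|.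
Definition lcross k := #|[set l : 'I_n | [&& s k < s l, s l < k & k < l]]|.
Definition lnest k := #|[set l : 'I_n | [&& s l < s k, s k < k & k < l]]|.

Lemma ucrosscval_sum : ucrosscval s = \sum_(j < n) (j < (s^-1)%g j) * ucross j.
Proof.
by apply: (nquad_upper (F := fun i _ => s i) (G := fun _ j => s j)
  (T := fun j : 'I_n => j < (s^-1)%g j)) => i j k l.
Qed.

Lemma ucrosscdrise_sum :
  ucrosscdrise s = \sum_(j < n) ((s^-1)%g j < j) * ucross j.
Proof.
by apply: (nquad_upper (F := fun i _ => s i) (G := fun _ j => s j)
  (T := fun j : 'I_n => (s^-1)%g j < j)) => i j k l.
Qed.

Lemma unestcval_sum : unestcval s = \sum_(j < n) (j < (s^-1)%g j) * unest j.
Proof.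
by apply: (nquad_upper (F := fun _ j => s j) (G := fun i _ => s i)
  (T := fun j : 'I_n => j < (s^-1)%g j)) => i j k l; rewrite andbCA.
Qed.

Lemma unestcdrise_sum : unestcdrise s = \sum_(j < n) ((s^-1)%g j < j) * unest j.
Proof.
by apply: (nquad_upper (F := fun _ j => s j) (G := fun i _ => s i)
  (T := fun j : 'I_n => (s^-1)%g j < j)) => i j k l; rewrite andbCA.
Qed.

Lemma lcrosscpeak_sum : lcrosscpeak s = \sum_(j < n) ((s^-1)%g j < j) * lcross j.
Proof.
by apply: (nquad_lower (F := fun k _ => s k) (G := fun _ l => s l)
  (T := fun j : 'I_n => (s^-1)%g j < j)) => i j k l.
Qed.

Lemma lcrosscdfall_sum :
  lcrosscdfall s = \sum_(j < n) (j < (s^-1)%g j) * lcross j.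
Proof.
by apply: (nquad_lower (F := fun k _ => s k) (G := fun _ l => s l)
  (T := fun j : 'I_n => j < (s^-1)%g j)) => i j k l.
Qed.

Lemma lnestcpeak_sum : lnestcpeak s = \sum_(j < n) ((s^-1)%g j < j) * lnest j.
Proof.
by apply: (nquad_lower (F := fun _ l => s l) (G := fun k _ => s k)
  (T := fun j : 'I_n => (s^-1)%g j < j)) => i j k l.
Qed.

Lemma lnestcdfall_sum : lnestcdfall s = \sum_(j < n) (j < (s^-1)%g j) * lnest j.
Proof.
by apply: (nquad_lower (F := fun _ l => s l) (G := fun k _ => s k)
  (T := fun j : 'I_n => j < (s^-1)%g j)) => i j k l.
Qed.

Lemma ucross_nexc j : s j <= j -> ucross j = 0.
Proof.
move=> le_j; apply/eqP; rewrite cards_eq0; apply/eqP/setP => i.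
by rewrite !inE; lia.
Qed.

Lemma unest_nexc j : s j <= j -> unest j = 0.
Proof.
move=> le_j; apply/eqP; rewrite cards_eq0; apply/eqP/setP => i.
by rewrite !inE; lia.
Qed.

Lemma lcross_nantiexc j : j <= s j -> lcross j = 0.
Proof.
move=> le_j; apply/eqP; rewrite cards_eq0; apply/eqP/setP => i.
by rewrite !inE; lia.
Qed.

Lemma lnest_nantiexc j : j <= s j -> lnest j = 0.
Proof.
move=> le_j; apply/eqP; rewrite cards_eq0; apply/eqP/setP => i.
by rewrite !inE; lia.
Qed.

Lemma perm_ord_eq i j : (s i == s j :> nat) = (i == j :> nat).
Proof. by rewrite !val_eqE (inj_eq perm_inj). Qed.

Lemma label_unest j : j < s j -> label s j = unest j.
Proof.
move=> lt_j; rewrite /label lt_j.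
by apply: eq_card => i; rewrite !inE; lia.
Qed.

Lemma label_lnest j : s j < j -> label s j = lnest j.
Proof.
move=> lt_j; rewrite /label ltnNge (ltnW lt_j) /=.
by apply: eq_card => i; rewrite !inE; lia.
Qed.

Lemma lev_cross_nest j : j < s j -> lev s j = ucross j + unest j.
Proof.
move=> lt_j; rewrite /lev /ucross /unest !card_set_sum -big_split.
apply: eq_bigr => i _ /=; have := perm_ord_eq i j; lia.
Qed.

Lemma colev_cross_nest j : s j < j -> colev s j = lcross j + lnest j.
Proof.
move=> lt_j; rewrite /colev /lcross /lnest !card_set_sum -big_split.
apply: eq_bigr => i _ /=; have := perm_ord_eq i j; lia.
Qed.

(** The arc from j passes over the cut between j and j + 1, so some arc comes back
    under it: it starts right of j and takes a value at most j. *)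
Lemma exc_antirecord j : j < s j -> antirecord s j = false.
Proof.
move=> lt_j; apply/negbTE/forallPn => /=.
have: 0 < height s j.+1 by rewrite heightS_lev lt_j addn1.
rewrite height_lower => /card_gt0P[l]; rewrite inE => lt_l; exists l; lia.
Qed.

Lemma exc_record j : j < s j -> record s j = (label s j == 0).
Proof.
move=> lt_j; rewrite /label lt_j cards_eq0; apply/forallP/eqP => [rec_j|no_j i].
  by apply/setP => i; rewrite !inE; have := rec_j i; lia.
apply/implyP => lt_ij; have /setP/(_ i) := no_j; rewrite !inE lt_ij /=.
have := perm_ord_eq i j; lia.
Qed.

Lemma antiexc_record j : s j < j -> record s j = false.
Proof.
move=> lt_j; apply/negbTE/forallPn.
have /card_gt0P[i]: 0 < height s j by rewrite height_colev lt_j addn1.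
by rewrite inE => lt_i; exists i; lia.
Qed.

Lemma antiexc_antirecord j : s j < j -> antirecord s j = (label s j == 0).
Proof.
move=> lt_j; rewrite /label ltnNge (ltnW lt_j) /= cards_eq0.
apply/forallP/eqP => [rec_j|no_j i].
  by apply/setP => i; rewrite !inE; have := rec_j i; lia.
apply/implyP => lt_ij; have /setP/(_ i) := no_j; rewrite !inE lt_ij /=.
have := perm_ord_eq i j; lia.
Qed.

(** This is what tells a fixed point from a cycle double fall, whose label is
    less than the height. *)
Lemma label_fix j : s j = j -> label s j = height s j.
Proof.
move=> sj; rewrite height_colev /label sj ltnn addn0.
by apply: eq_card => i; rewrite !inE andbC.
Qed.

End Statistics.

(** * Local weights *)

Section LocalWeights.
Local Open Scope ring_scope.
Variable R : comNzRingType.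
Variables (x1 x2 y1 y2 u1 u2 v1 v2 : R) (w : nat -> R).
Variables (pp1 pp2 pm1 pm2 qp1 qp2 qm1 qm2 s : R).

(** The weight of an index with r nestings among the k arcs passing it; x stands
    for a record or antirecord, u for neither. *)
Definition pq_weight (p q x u : R) (k r : nat) : R :=
  p ^+ (k - r) * q ^+ r * (if r == 0%N then x else u).

Definition letter_weight (h : nat) (x : letter) : R :=
  let: (a, b, r) := x in
  match a, b with
  | true, false => pq_weight pp1 qp1 y1 v1 h r
  | true, true => pq_weight pp2 qp2 y2 v2 h.-1 r
  | false, true => pq_weight pm1 qm1 x1 u1 h.-1 r
  | false, false =>
      if r == h then s ^+ h * w h else pq_weight pm2 qm2 x2 u2 h.-1 r
  end.

Lemma sum_pq_weight p q x u k :
  \sum_(r < k.+1) pq_weight p q x u k r = p ^+ k * x + q * pqnum p q k * u.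
Proof.
rewrite big_ord_recl /pq_weight subn0 expr0 mulr1 /=; congr (_ + _).
rewrite /pqnum mulr_sumr mulr_suml (reindex_inj rev_ord_inj) /=.
apply: eq_bigr => r _; rewrite /bump /= add1n; congr (_ * _).
rewrite mulrCA -exprS; congr (_ ^+ _ * _ ^+ _); have := ltn_ord r; lia.
Qed.

Definition local_monomial n (sg : 'S_n) (i : 'I_n) : R :=
    x1 ^+ (exantirecord sg i && cpeak sg i) *
    x2 ^+ (exantirecord sg i && cdfall sg i) *
    y1 ^+ (exrecord sg i && cval sg i) * y2 ^+ (exrecord sg i && cdrise sg i) *
    u1 ^+ (neither_record sg i && cpeak sg i) *
    u2 ^+ (neither_record sg i && cdfall sg i) *
    v1 ^+ (neither_record sg i && cval sg i) *
    v2 ^+ (neither_record sg i && cdrise sg i) *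
    (if sg i == i then w (lev sg i) else 1) *
    pp1 ^+ ((i < (sg^-1)%g i)%N * ucross sg i) *
    pp2 ^+ (((sg^-1)%g i < i)%N * ucross sg i) *
    pm1 ^+ (((sg^-1)%g i < i)%N * lcross sg i) *
    pm2 ^+ ((i < (sg^-1)%g i)%N * lcross sg i) *
    qp1 ^+ ((i < (sg^-1)%g i)%N * unest sg i) *
    qp2 ^+ (((sg^-1)%g i < i)%N * unest sg i) *
    qm1 ^+ (((sg^-1)%g i < i)%N * lnest sg i) *
    qm2 ^+ ((i < (sg^-1)%g i)%N * lnest sg i) *
    s ^+ ((sg i == i) * lev sg i).

(** Unless i is fixed, the arcs over or under it split into crossings and
    nestings, the label counts the nestings, and one of the two record
    conditions is decided by the label while the other one fails.  If i is
    fixed, only the factors in w and s remain. *)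
Lemma local_monomial_letter n (sg : 'S_n) i :
  local_monomial sg i = letter_weight (height sg i) (perm_letter sg i).
Proof.
rewrite /local_monomial /exrecord /exantirecord /neither_record.
rewrite /cpeak /cval /cdfall /cdrise /perm_letter -val_eqE /=.
have invE : ((sg^-1)%g i == i :> nat) = (sg i == i :> nat).
  by rewrite !val_eqE eq_sym eq_permV.
have [lt_i|gt_i|/val_inj/esym eq_i] := ltngtP (i : nat) (sg i).
- rewrite exc_antirecord // exc_record // lcross_nantiexc ?(ltnW lt_i) //.
  rewrite lnest_nantiexc ?(ltnW lt_i) // height_lev lev_cross_nest //.
  rewrite label_unest //.
  move: invE; rewrite [sg i == _ :> nat]gtn_eqF // /pq_weight.
  by case: ltngtP => //= _ _; case: eqP => /= _;
    rewrite ?mul0n ?mul1n ?muln0 ?addn1 ?addn0 /= addnK; ring.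
- rewrite antiexc_record // antiexc_antirecord // ucross_nexc ?(ltnW gt_i) //.
  rewrite unest_nexc ?(ltnW gt_i) // height_colev colev_cross_nest //.
  have lt_label : (lnest sg i < (lcross sg i + lnest sg i).+1)%N.
    by rewrite ltnS leq_addl.
  rewrite label_lnest // gt_i addn1 (ltn_eqF lt_label) /pq_weight.
  move: invE; rewrite [sg i == _ :> nat]ltn_eqF //.
  by case: ltngtP => //= _ _; case: eqP => /= _;
    rewrite ?mul0n ?mul1n ?muln0 addnK; ring.
have inv_i : (sg^-1)%g i = i by rewrite -{1}eq_i permK.
rewrite label_fix // height_lev inv_i ltnn addn0 eqxx !andbF /= !mul0n mul1n.
ring.
Qed.

Lemma Qpoly_letter n :
  Qpoly x1 x2 y1 y2 u1 u2 v1 v2 w pp1 pp2 pm1 pm2 qp1 qp2 qm1 qm2 s n =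
  \sum_(sg : 'S_n) \prod_(i < n) letter_weight (height sg i) (perm_letter sg i).
Proof.
apply: eq_bigr => sg _; transitivity (\prod_i local_monomial sg i); last first.
  by apply: eq_bigr => i _; apply: local_monomial_letter.
rewrite !big_split /= !prodrXr psnest_sum ucrosscval_sum ucrosscdrise_sum.
rewrite lcrosscpeak_sum lcrosscdfall_sum unestcval_sum unestcdrise_sum.
rewrite lnestcpeak_sum lnestcdfall_sum (big_mkcond (fun i => sg i == i)).
rewrite /eareccpeak /eareccdfall /ereccval /ereccdrise.
by rewrite /nrcpeak /nrcdfall /nrcval /nrcdrise !card_set_sum.
Qed.

End LocalWeights.

(** * J-fractions *)

Local Open Scope ring_scope.

Section Series.
Variable R : comNzRingType.
Implicit Types f g h : fps R.

(** Coefficients of degree less than N only see the truncations at N, so the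
    ring laws of polynomials carry over. *)
Lemma fps_mul_poly N f g n : (n < N)%N ->
  fps_mul f g n = ((\poly_(i < N) f i) * (\poly_(i < N) g i))`_n.
Proof.
move=> ltnN; rewrite coefM; apply: eq_bigr => i _.
rewrite !coef_poly (leq_ltn_trans (leq_ord i) ltnN).
by rewrite (leq_ltn_trans (leq_subr _ _) ltnN).
Qed.

Lemma fps_mulC f g : fps_mul f g =1 fps_mul g f.
Proof. by move=> n; rewrite !(@fps_mul_poly n.+1) // mulrC. Qed.

Lemma fps_mulA f g h :
  fps_mul f (fps_mul g h) =1 fps_mul (fps_mul f g) h.
Proof.
move=> n; pose P f : {poly R} := \poly_(i < n.+1) f i.
transitivity ((P f * (P g * P h))`_n); last rewrite mulrA.
  rewrite coefM; apply: eq_bigr => i _; rewrite coef_poly ltn_ord.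
  by rewrite (@fps_mul_poly n.+1) // ltnS leq_subr.
rewrite coefM; apply: eq_bigr => i _.
by rewrite -(@fps_mul_poly n.+1) // coef_poly ltnS leq_subr.
Qed.

Lemma eq_fps_mul f g g' n : (forall i, (i <= n)%N -> g i = g' i) ->
  fps_mul f g n = fps_mul f g' n.
Proof. by move=> eqg; apply: eq_bigr => i _; rewrite eqg ?leq_subr. Qed.

Lemma fps_mulCA f g h n :
  fps_mul f (fps_mul g h) n = fps_mul g (fps_mul f h) n.
Proof.
rewrite !fps_mulA fps_mulC [RHS]fps_mulC.
by apply: eq_fps_mul => i _; rewrite fps_mulC.
Qed.

Lemma fps_mulBl f g h n :
  fps_mul (fps_sub f g) h n = fps_mul f h n - fps_mul g h n.
Proof. by rewrite -sumrB; apply: eq_bigr => i _; rewrite mulrBl. Qed.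

Lemma fps_mul_monom c d f n :
  fps_mul (fps_monom c d) f n = if (n < d)%N then 0 else c * f (n - d)%N.
Proof.
rewrite /fps_mul /fps_monom; case: ltnP => [ltnd|ledn].
  by rewrite big1 // => i _; rewrite ltn_eqF ?mul0r // (leq_trans (ltn_ord i)).
have ltd: (d < n.+1)%N by [].
rewrite (bigD1 (Ordinal ltd)) //= eqxx big1 ?addr0 // => i.
by rewrite -val_eqE /= => /negPf ->; rewrite mul0r.
Qed.

Lemma fps_mul1 f n : fps_mul (fps_const 1) f n = f n.
Proof.
by rewrite -[fps_const 1]/(fps_monom 1 0) fps_mul_monom subn0 mul1r.
Qed.

(** Let f_h be the series of the F n h.  The recurrence says
    (1 - gamma_h t) f_h = down_h t f_(h-1) + up_h t f_(h+1), with 1 in place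
    of down_h t f_(h-1) for h = 0.  If f_(h+1) is down_(h+1) t J f_h, where J is
    a convergent of the fraction started at level h + 1, this becomes
    (1 - gamma_h t - beta_(h+1) t^2 J) f_h = down_h t f_(h-1), and so f_h is
    down_h t f_(h-1) times the next convergent started at level h.  As f_h
    is divisible by t^h, the convergents of depth 0 hold up to order h + 2,
    and each level of depth adds 2 to the precision. *)
Lemma Jfraction_of_recurrence (gamma beta up down : nat -> R)
    (F : nat -> nat -> R) :
    down 0%N = 0 -> (forall h : nat, beta h.+1 = up h * down h.+1) ->
    (forall h : nat, F 0%N h = (h == 0%N)%:R) ->
    (forall n h : nat, F n.+1 h =
       up h * F n h.+1 + gamma h * F n h + down h * F n h.-1) ->
  is_Jfraction gamma beta (fun n => F n 0%N).
Proof.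
move=> down0 betaE F0 FS.
have F_low n (h : nat) : (n < h)%N -> F n h = 0.
  elim: n h => [|n IH] [|h] lt_nh //.
  by rewrite FS !IH ?mulr0 ?addr0 //; lia.
pose f (h : nat) : fps R := F^~ h.
pose src (h : nat) : fps R :=
  if h is h'.+1 then fps_mul (fps_monom (down h) 1) (f h') else fps_const 1.
pose den0 (h : nat) := fps_sub (fps_const 1) (fps_monom (gamma h) 1).
have srcE (h : nat) n :
    src h n =
      fps_mul (den0 h) (f h) n - fps_mul (fps_monom (up h) 1) (f h.+1) n.
  rewrite fps_mulBl fps_mul1 !fps_mul_monom {1}/f.
  case: n => [|n].
    by rewrite F0 !subr0; case: h => [|h] //; rewrite [LHS]fps_mul_monom.
  rewrite /= subn1 /= FS; case: h => [|h] /=.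
    by rewrite /fps_const /= down0 /f; ring.
  by rewrite fps_mul_monom /= subn1 /= /f; ring.
have div_den (D X : fps R) (h N : nat) : D 0%N = 1 ->
    (forall n, (n < N)%N -> fps_mul D (f h) n = X n) ->
  forall n, (n < N)%N -> F n h = fps_mul (fps_inv D) X n.
  move=> D0 DfX n ltnN.
  transitivity (fps_mul (fps_inv D) (fps_mul D (f h)) n); last first.
    by apply: eq_fps_mul => i lein; rewrite DfX // (leq_ltn_trans lein).
  rewrite fps_mulA fps_mulC.
  transitivity (fps_mul (f h) (fps_const 1) n); last first.
    by apply: eq_fps_mul => i _; rewrite fps_mulC fps_mul_inv.
  by rewrite fps_mulC fps_mul1.
have approx k (h : nat) n : (n < h + k.*2.+2)%N ->
    F n h = fps_mul (Jconvergent gamma beta k h) (src h) n.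
  elim: k h n => [|k IH] h n /=; apply: div_den => {n}.
  - by rewrite /fps_sub /fps_const /fps_monom /= subr0.
  - move=> n lt_n; rewrite srcE fps_mul_monom; case: n lt_n => [|n] lt_n /=.
      by rewrite subr0.
    by rewrite subn1 /= [f _ _]F_low ?mulr0 ?subr0 //; lia.
  - rewrite /fps_sub (fps_mul_monom _ _ _ 0) /=.
    by rewrite /fps_const /fps_monom /= !subr0.
  move=> n lt_n; rewrite srcE fps_mulBl; congr (_ - _).
  rewrite -fps_mulA !fps_mul_monom; case: n lt_n => [|n] lt_n //=.
  rewrite subn1 /= [f _ _]IH; last by lia.
  rewrite fps_mulCA fps_mul_monom; case: n lt_n => [|n] _ /=.
    by rewrite mulr0.
  by rewrite subn1 subn2 /= betaE mulrA.
move=> n; exists n => k le_nk; rewrite (approx k); last by lia.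
by rewrite fps_mulC fps_mul1.
Qed.

End Series.

(** * The continued fraction of Q_n *)

Theorem theorem2p7 (R : comNzRingType)
    (x1 x2 y1 y2 u1 u2 v1 v2 : R) (w : nat -> R)
    (pp1 pp2 pm1 pm2 qp1 qp2 qm1 qm2 s : R)
    (gamma beta : nat -> R)
    (gamma0 : gamma 0%N = w 0%N)
    (gammaS : forall n : nat, (1 <= n)%N ->
       gamma n = (pm2 ^+ (n - 1) * x2 + qm2 * pqnum pm2 qm2 (n - 1) * u2)
               + (pp2 ^+ (n - 1) * y2 + qp2 * pqnum pp2 qp2 (n - 1) * v2)
               + s ^+ n * w n)
    (betaS : forall n : nat, (1 <= n)%N ->
       beta n = (pm1 ^+ (n - 1) * x1 + qm1 * pqnum pm1 qm1 (n - 1) * u1)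
              * (pp1 ^+ (n - 1) * y1 + qp1 * pqnum pp1 qp1 (n - 1) * v1)) :
  is_Jfraction gamma beta
    (Qpoly x1 x2 y1 y2 u1 u2 v1 v2 w
           pp1 pp2 pm1 pm2 qp1 qp2 qm1 qm2 s).
Proof.
pose W := letter_weight x1 x2 y1 y2 u1 u2 v1 v2 w
            pp1 pp2 pm1 pm2 qp1 qp2 qm1 qm2 s.
have QE n : Qpoly x1 x2 y1 y2 u1 u2 v1 v2 w
    pp1 pp2 pm1 pm2 qp1 qp2 qm1 qm2 s n = path_sum W n 0.
  by rewrite Qpoly_letter sum_weight_code.
pose up (h : nat) := \sum_(r < h.+1) W h (true, false, r : nat).
pose down (h : nat) := \sum_(r < h) W h (false, true, r : nat).
have down0 : down 0%N = 0 by rewrite /down big_ord0.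
have upE h : up h = pp1 ^+ h * y1 + qp1 * pqnum pp1 qp1 h * v1.
  exact: sum_pq_weight.
have downE h : down h.+1 = pm1 ^+ h * x1 + qm1 * pqnum pm1 qm1 h * u1.
  exact: sum_pq_weight.
have gammaE h : gamma h = \sum_(r < h) W h (true, true, r : nat) +
    \sum_(r < h.+1) W h (false, false, r : nat).
  (* The largest label of a (false, false) letter is that of a fixed point. *)
  rewrite [in RHS]big_ord_recr /= eqxx; case: h => [|h].
    by rewrite !big_ord0 gamma0 !add0r expr0 mul1r.
  rewrite gammaS // subn1 /= [RHS]addrA; congr (_ + _).
  rewrite -!sum_pq_weight addrC; congr (_ + _); apply: eq_bigr => r _ //.
  by rewrite ltn_eqF.
move=> n; case: (@Jfraction_of_recurrence R gamma beta up down (path_sum W) down0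
  _ _ _ n) => [h|h|m h|K HK].
- by rewrite betaS // subn1 /= mulrC upE downE.
- by rewrite /path_sum /=; case: h => [|h]; rewrite ?big_nil ?big_seq1.
- rewrite path_sumS big_steps /up gammaE /down !mulr_suml mulrDl !mulr_suml.
  rewrite /next_height /= !addn1 !addn0 !subn0 !subn1 /=; ring.
by exists K => k leKk; rewrite QE HK.
Qed.
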